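(* Let $n$ be a positive integer and $p$ a positive divisor of $n$. A permutation $\pi\in S_n$ has a difference sequence that is periodic with period dividing $p$ if and only if there exists a triple \[(\varphi,\mathcal R,k)\in S_p\times\prod_{i=1}^{p}\left(\{0\}\cup\left[\tfrac{n}{p}-1\right]\right)\times\mathbb Z_{n/p}\] with $\gcd(k,\tfrac np)=1$ such that for all $i\in\mathbb Z_n$, \[\pi(i)=\mathcal R_{i \bmod p}\cdot p+\varphi(i\bmod p)+kp\left\lfloor\tfrac{i-1}{p}\right\rfloor .\] Moreover, $\pi$ is uniquely determined by such a triple.
   Context: Permutations in $S_n$ are bijections of $\mathbb Z_n$, written $[\pi(1)\ \cdots\ \pi(n)]$, with elements of $\mathbb Z_n$ represented by $1,\dots,n$ (so values of the displayed formula are read modulo $n$, and $i\bmod p$ denotes the representative in $\{1,\dots,p\}$). $[m]=\{1,\dots,m\}$. The difference sequence of $\pi\in S_n$ is $D_\pi\in\mathbb Z_n^n$ with $D_\pi(k)=\pi(k+1)-\pi(k)$ for $1\le k<n$ and $D_\pi(n)=\pi(1)-\pi(n)$; it is periodic with period dividing $p$ if $D_\pi(k+p)=D_\pi(k)$ for all $k$ (indices mod $n$). *)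

(* Defs.v *)
From mathcomp Require Import all_boot all_algebra fingroup perm.

Set Implicit Arguments.
Unset Strict Implicit.
Unset Printing Implicit Defensive.

Import GRing.Theory.
Local Open Scope ring_scope.

(* Z_n as an additive group, for every n > 0; the library's 'Z_n is Z_2 when
   n = 1. *)
Notation Zmod n := ('I_n.-1.+1).

(* The representative of x in {1, ..., n}; the underlying ordinal is the one
   in {0, ..., n - 1}. *)
Definition rep1 (n : nat) (x : Zmod n) : nat :=
  if val x == 0%N then n else val x.

Arguments rep1 n x : clear implicits.

(* Indices are added in Z_n, so the value at the index n is pi(1) - pi(n). *)
Definition diffseq (n : nat) (pi : {perm Zmod n}) : {ffun Zmod n -> Zmod n} :=
  [ffun k => pi (k + inZp 1) - pi k].

Definition period_dvd (n p : nat) (D : {ffun Zmod n -> Zmod n}) : Prop :=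
  forall k : Zmod n, D (k + inZp p) = D k.

(* The components are phi, R and k; 'I_(n %/ p) is {0} \cup [n / p - 1]. *)
Definition triple (n p : nat) : Type :=
  ({perm Zmod p} * {ffun Zmod p -> 'I_(n %/ p)} * Zmod (n %/ p))%type.

Definition admissible (n p : nat) (t : triple n p) : Prop :=
  gcdn (rep1 (n %/ p) t.2) (n %/ p) = 1%N.

(* The sum is formed in nat on representatives and then reduced modulo n. *)
Definition triple_fun (n p : nat) (t : triple n p) (i : Zmod n) : Zmod n :=
  let: (phi, R, k) := t in
  let ip : Zmod p := inZp (rep1 n i) in
  inZp (R ip * p + rep1 p (phi ip) + rep1 (n %/ p) k * p * ((rep1 n i).-1 %/ p))%N.

Definition represents (n p : nat) (t : triple n p) (pi : {perm Zmod n}) : Prop :=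
  admissible t /\ forall i : Zmod n, pi i = triple_fun t i.

(* Main.v *)
(** Shift indices to [i = j + 1] with [j >= 0], and write [m = n / p].
    Periodicity of the difference sequence says exactly that
    [c = pi (i + p) - pi i] does not depend on [i], so [pi (i + t p) = pi i + t c].
    Since [pi] is injective, [c] has additive order [m] in [Z_n]; hence
    [c = k p] with [k] prime to [m], and [c] generates [p Z_n].  Therefore [pi]
    permutes the classes modulo [p], which gives [phi], and the remaining data
    are the quotients by [p] of the values of [pi] on [1, ..., p], which
    give [R]. *)

Require Import Defs.
From mathcomp Require Import all_boot all_algebra fingroup perm.

Import GRing.Theory.

(** * Residues and their positive representatives *)

Lemma coprime_eqn_modMl (d k a b : nat) : coprime d k ->
  (k * a == k * b %[mod d]) = (a == b %[mod d]).
Proof.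
move=> co; wlog ba : a b / b <= a => [wl|]; last first.
  by rewrite !eqn_mod_dvd ?leq_mul // -mulnBr Gauss_dvdr.
have [/wl //|/ltnW/wl] := leqP b a.
by rewrite eq_sym => ->; rewrite eq_sym.
Qed.

Section Residues.

Variables (n : nat) (n_gt0 : 0 < n).

Lemma val_inZp (a : nat) : (inZp a : Zmod n) = a %% n :> nat.
Proof. by rewrite /= prednK. Qed.

Lemma Zmod_ltn (x : Zmod n) : x < n.
Proof. by case: x => x /=; rewrite prednK. Qed.

Lemma inZp_eqP (a b : nat) : (inZp a = inZp b :> Zmod n) <-> a = b %[mod n].
Proof.
split=> [/(congr1 (@nat_of_ord _))|e]; first by rewrite !val_inZp.
by apply: ord_inj; rewrite !val_inZp.
Qed.

Lemma inZp_val (x : Zmod n) : inZp x = x.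
Proof. by apply: ord_inj; rewrite val_inZp modn_small ?Zmod_ltn. Qed.

Lemma inZp0 : inZp 0 = 0%R :> Zmod n.
Proof. by apply: ord_inj; rewrite /= mod0n. Qed.

Lemma inZpD (a b : nat) : inZp (a + b) = (inZp a + inZp b)%R :> Zmod n.
Proof. by apply: ord_inj; rewrite /= modnDm. Qed.

Lemma inZpM (a b : nat) : inZp (a * b) = (inZp a *+ b)%R :> Zmod n.
Proof.
elim: b => [|b IHb]; last by rewrite mulnS inZpD IHb mulrS.
by rewrite muln0 mulr0n inZp0.
Qed.

Lemma inZp_eq0 (a : nat) : (inZp a == 0 :> Zmod n)%R = (n %| a).
Proof. by rewrite -val_eqE /= prednK. Qed.

Lemma rep1E (x : Zmod n) : rep1 n x = if x == 0 :> nat then n else x.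
Proof. by []. Qed.

(** Writing indices as [j.+1] avoids the case split in [rep1] and turns the floor of [(i - 1) / p]
    into a quotient of [j]. *)
Lemma rep1_inZpS (a : nat) : rep1 n (inZp a.+1) = (a %% n).+1.
Proof.
rewrite rep1E val_inZp -[a.+1]addn1 -modnDml addn1.
have : (a %% n).+1 <= n by rewrite ltn_mod.
by rewrite leq_eqVlt => /predU1P[->|lt]; rewrite ?modnn // modn_small.
Qed.

Lemma rep1_mod (x : Zmod n) : rep1 n x = x %[mod n].
Proof. by rewrite rep1E; case: eqP => // ->; rewrite modnn mod0n. Qed.

Lemma inZp_rep1 (x : Zmod n) : inZp (rep1 n x) = x.
Proof. by rewrite -[RHS]inZp_val; apply/inZp_eqP/rep1_mod. Qed.

Lemma rep1_gt0 (x : Zmod n) : 0 < rep1 n x.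
Proof. by rewrite rep1E; case: eqP => // /eqP; rewrite lt0n. Qed.

Lemma rep1_pred_ltn (x : Zmod n) : (rep1 n x).-1 < n.
Proof.
by rewrite (prednK (rep1_gt0 x)) rep1E; case: eqP => // _; apply/ltnW/Zmod_ltn.
Qed.

Lemma inZp_rep1_pred (x : Zmod n) : inZp (rep1 n x).-1.+1 = x.
Proof. by rewrite (prednK (rep1_gt0 x)) inZp_rep1. Qed.

Lemma inZp_surj (x : Zmod n) : exists2 j : nat, j < n & x = inZp j.+1.
Proof. by exists (rep1 n x).-1; rewrite ?rep1_pred_ltn // inZp_rep1_pred. Qed.

End Residues.

(** Periodicity makes [pi (x + p) - pi x] invariant under [x -> x + 1]; induction from [x = 0] makes
    it constant. *)
Lemma period_dvd_diffseqP (n p : nat) (n_gt0 : 0 < n) (pi : {perm Zmod n}) :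
  period_dvd p (diffseq pi) <->
  exists c : Zmod n, forall x : Zmod n, (pi (x + inZp p) = pi x + c)%R.
Proof.
split=> [per|[c pic] k]; last first.
  by rewrite !ffunE addrAC !pic opprD addrACA subrr addr0.
exists (pi (inZp p) - pi 0)%R => x.
rewrite -(inZp_val n n_gt0 x); elim: (val x) => [|j IHj].
  by rewrite inZp0 add0r addrC subrK.
have := per (inZp j); rewrite !ffunE IHj -[j.+1]addn1 inZpD.
rewrite [(_ + inZp p + _)%R]addrAC => /eqP; rewrite subr_eq => /eqP ->.
by rewrite addrA subrK.
Qed.

(** * From triples to permutations *)

Section Triples.

Variables (n p : nat) (n_gt0 : 0 < n) (p_gt0 : 0 < p) (p_dvd_n : p %| n).

Let m := n %/ p.

Let m_gt0 : 0 < m. Proof. by rewrite divn_gt0 // dvdn_leq. Qed.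

Let mp : m * p = n. Proof. exact: divnK. Qed.

Lemma eqmod_dvd (a b : nat) : a = b %[mod n] -> a = b %[mod p].
Proof. by move=> e; rewrite -(modn_dvdm a p_dvd_n) e modn_dvdm. Qed.

Lemma eqmod_mul (a b : nat) : a * p = b * p %[mod n] <-> a = b %[mod m].
Proof.
rewrite -mp -!muln_modl; split=> [/eqP|->//].
by rewrite eqn_pmul2r // => /eqP.
Qed.

(** No bound on [j] is required: reducing [j] modulo [n] changes [j %/ p] by a multiple of [m],
    hence the last term by a multiple of [m * p = n]. *)
Lemma triple_funE (phi : {perm Zmod p}) (R : {ffun Zmod p -> 'I_m}) (k : Zmod m)
    (j : nat) :
  triple_fun ((phi, R, k) : triple n p) (inZp j.+1) =
  inZp (R (inZp j.+1) * p + rep1 p (phi (inZp j.+1)) + rep1 m k * p * (j %/ p)).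
Proof.
rewrite /triple_fun rep1_inZpS //=.
have -> : inZp (j %% n).+1 = inZp j.+1 :> Zmod p.
  by apply/inZp_eqP => //; apply: eqmod_dvd; rewrite -addn1 modnDml addn1.
have jE : j %/ p = j %/ n * m + (j %% n) %/ p.
  by rewrite {1}(divn_eq j n) -{2}mp mulnA divnMDl.
apply/inZp_eqP => //; apply/eqP; rewrite eqn_modDl jE mulnDr.
by rewrite mulnACA [p * m]mulnC mp modnMDl.
Qed.

(** A step of [p] keeps the index modulo [p] and raises the floor by one. *)
Lemma triple_fun_shift (phi : {perm Zmod p}) (R : {ffun Zmod p -> 'I_m})
    (k : Zmod m) (x : Zmod n) :
  triple_fun ((phi, R, k) : triple n p) (x + inZp p)%R =
  (triple_fun ((phi, R, k) : triple n p) x + inZp (rep1 m k * p))%R.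
Proof.
have [j _ ->] := inZp_surj n n_gt0 x.
rewrite -inZpD // addSn !triple_funE -inZpD //.
have -> : inZp (j + p).+1 = inZp j.+1 :> Zmod p.
  by apply/inZp_eqP => //; rewrite -addSn modnDr.
by rewrite divnDr ?divnn // p_gt0 addn1 mulnS -!addnA [in RHS](addnC _ (_ * p)).
Qed.

(** All terms except the one in [phi] are multiples of [p]. *)
Lemma triple_fun_mod (phi : {perm Zmod p}) (R : {ffun Zmod p -> 'I_m})
    (k : Zmod m) (j : nat) :
  inZp (triple_fun ((phi, R, k) : triple n p) (inZp j.+1)) = phi (inZp j.+1).
Proof.
rewrite triple_funE -[RHS]inZp_rep1 //; apply/inZp_eqP => //.
apply: etrans (_ : (_ + _) %% p = _); first by rewrite val_inZp // modn_dvdm.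
by rewrite -addnA modnMDl mulnAC addnC modnMDl.
Qed.

(** Equal values force equal indices modulo [p], through [phi]. Cancelling [k], a unit modulo [m],
    then gives equal quotients by [p], both below [m]. *)
Lemma triple_fun_inj (t : triple n p) : admissible t -> injective (triple_fun t).
Proof.
case: t => [[phi R] k] adm x y.
have [j jn ->] := inZp_surj n n_gt0 x; have [l ln ->] := inZp_surj n n_gt0 y.
move=> e; have ejl : inZp j.+1 = inZp l.+1 :> Zmod p.
  by apply: (@perm_inj _ phi); rewrite -!(triple_fun_mod phi R k) e.
move: e; rewrite !triple_funE ejl => /inZp_eqP -/(_ n_gt0) /eqP.
rewrite eqn_modDl ![rep1 m k * p * _]mulnAC => /eqP/eqmod_mul/eqP.
rewrite coprime_eqn_modMl; last by rewrite coprime_sym; apply/eqP.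
rewrite !modn_small ?ltn_divLR ?mp // => /eqP eq.
move/inZp_eqP: ejl => /(_ p_gt0)/eqP; rewrite -addn1 -[l.+1]addn1 eqn_modDr => /eqP er.
by rewrite (divn_eq j p) eq er -divn_eq.
Qed.

(** The values modulo [p] give [phi], the shift by [p] gives [k], and what remains gives [R], whose
    values are below [m]. *)
Lemma triple_fun_injl (t t' : triple n p) :
  triple_fun t =1 triple_fun t' -> t = t'.
Proof.
case: t t' => [[phi R] k] [[phi' R'] k'] e.
have ephi : phi = phi'.
  apply/permP => x; have [j _ ->] := inZp_surj p p_gt0 x.
  by rewrite -(triple_fun_mod phi R k) e triple_fun_mod.
subst phi'; have ek : k = k'.
  move: (e (0 + inZp p)%R); rewrite !triple_fun_shift e.
  move/addrI/inZp_eqP => /(_ n_gt0)/eqmod_mul ek.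
  by rewrite -(inZp_rep1 m m_gt0 k) -(inZp_rep1 m m_gt0 k'); apply/inZp_eqP.
subst k'; congr (_, _, _); apply/ffunP => x; apply: ord_inj => /=.
have [j _ ->] := inZp_surj p p_gt0 x.
move: (e (inZp j.+1)); rewrite !triple_funE => /inZp_eqP -/(_ n_gt0) /eqP.
rewrite !eqn_modDr => /eqP/eqmod_mul.
by rewrite !modn_small.
Qed.

(** * From a constant shift to a triple *)

Section FromPerm.

Variables (pi : {perm Zmod n}) (c : Zmod n).
Hypothesis pi_shift : forall x : Zmod n, (pi (x + inZp p) = pi x + c)%R.

Lemma perm_shift (x : Zmod n) (t : nat) :
  (pi (x + inZp (t * p)) = pi x + c *+ t)%R.
Proof.
elim: t => [|t IHt]; last by rewrite mulSnr inZpD // addrA pi_shift IHt mulrSr addrA.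
by rewrite mul0n mulr0n inZp0 !addr0.
Qed.

Lemma shift_mulrn_eq0 (t : nat) : (c *+ t = 0)%R -> m %| t.
Proof.
move=> ct; have := perm_shift 0%R t; rewrite ct addr0 => /perm_inj/eqP.
by rewrite add0r inZp_eq0 // -mp dvdn_pmul2r.
Qed.

Lemma shiftE : exists2 k : Zmod m,
  coprime m (rep1 m k) & c = inZp (rep1 m k * p).
Proof.
have cm : (c *+ m = 0)%R.
  have n0 : inZp n = 0%R :> Zmod n by apply/eqP; rewrite inZp_eq0.
  by have := perm_shift 0%R m; rewrite mp n0 addr0 => /esym/eqP; rewrite -subr_eq0 addrAC subrr add0r => /eqP.
(* [c *+ m = 0] says that [n = m * p] divides [c * m]. *)
have pc : p %| c.
  move/eqP: cm; rewrite -{1}(inZp_val n n_gt0 c) -inZpM // inZp_eq0 //.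
  by rewrite -{1}mp mulnC dvdn_pmul2r.
have ck : c = inZp (rep1 m (inZp (c %/ p)) * p).
  rewrite -[LHS]inZp_val //; apply/inZp_eqP => //.
  rewrite -[in LHS](divnK pc); apply/eqmod_mul.
  by rewrite rep1_mod // val_inZp // modn_mod.
exists (inZp (c %/ p)) => //; move: ck; set k := rep1 m _ => ck.
(* [m %/ g] already annihilates [c = k * p], so the order of [c] forces [g = 1]. *)
set g := gcdn m k; have g_gt0 : 0 < g by rewrite gcdn_gt0 m_gt0.
have : m %| m %/ g.
  apply: shift_mulrn_eq0; apply/eqP; rewrite ck -inZpM // inZp_eq0 // -mp mulnAC dvdn_pmul2r //.
  by rewrite muln_divA ?dvdn_gcdl // mulnC -muln_divA ?dvdn_gcdr // dvdn_mulr.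
move/(dvdn_leq _); rewrite divn_gt0 // dvdn_leq ?dvdn_gcdl // => /(_ isT).
rewrite leq_divRL ?dvdn_gcdl // -{2}[m]muln1 leq_pmul2l // => g1.
by rewrite /coprime eqn_leq g1.
Qed.

(** The values of [pi] on [1, ..., p]: their residues modulo [p] give [phi], their quotients give
    [R]. *)
Let pi1 (y : Zmod p) : Zmod n := pi (inZp (rep1 p y)).

(** Values congruent modulo [p] differ by a multiple of [p], hence of [c]; so the arguments differ
    by a multiple of [p]. *)
Lemma perm_mod_inj : injective (fun y : Zmod p => inZp (pi1 y) : Zmod p).
Proof.
have [k cop ck] := shiftE.
move=> x y; rewrite -{2}(inZp_rep1 p p_gt0 x) -{2}(inZp_rep1 p p_gt0 y) /pi1.
set a : Zmod n := inZp (rep1 p x); set b : Zmod n := inZp (rep1 p y).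
move=> /inZp_eqP -/(_ p_gt0) eab.
suff [t bE] : exists t, b = (a + inZp (t * p))%R.
  move: bE; rewrite -inZpD // => /inZp_eqP -/(_ n_gt0)/eqmod_dvd e.
  by apply/inZp_eqP => //; rewrite e addnC modnMDl.
have [s sE] : exists s, pi b = (pi a + inZp (s * p))%R.
  (* Adding [n] keeps the natural subtraction from truncating. *)
  have lt : pi a <= pi b + n by rewrite ltnW // ltn_addl // Zmod_ltn.
  have : p %| pi b + n - pi a.
    by rewrite -eqn_mod_dvd // -modnDmr (eqP p_dvd_n) addn0 eab.
  move=> dv; exists ((pi b + n - pi a) %/ p); rewrite divnK //.
  rewrite -{1}(inZp_val n n_gt0 (pi a)) -inZpD // subnKC //.
  by rewrite -[LHS]inZp_val //; apply/inZp_eqP => //; rewrite modnDr.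
(* Bezout: [u * k = v * m + 1] gives [c *+ u = p] in [Zmod n], so [s * u] shifts by [p] realise the
   difference [s * p]. *)
have /coprimeP : coprime (rep1 m k) m by rewrite coprime_sym.
case=> [|[u v] /= uv]; first exact: rep1_gt0.
exists (s * u); apply: (@perm_inj _ pi); rewrite perm_shift sE; congr (_ + _)%R.
rewrite ck -inZpM //; apply/inZp_eqP => //; rewrite mulnAC; apply/eqmod_mul.
have uE : u * rep1 m k = v * m + 1.
  by rewrite -uv subnKC //; apply: ltnW; rewrite -subn_gt0 uv.
by rewrite mulnC -mulnA uE mulnDr mulnA modnMDl muln1.
Qed.

Lemma rep1_quotient_ltn (z : Zmod n) : (rep1 n z).-1 %/ p < m.
Proof. by rewrite ltn_divLR // mp rep1_pred_ltn. Qed.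

(** Division by [p] with remainder in [1, ..., p]. *)
Lemma quotient_rep1K (z : Zmod n) :
  inZp ((rep1 n z).-1 %/ p * p + rep1 p (inZp z)) = z.
Proof.
have [l ln ->] := inZp_surj n n_gt0 z.
have -> : inZp (inZp l.+1 : Zmod n) = inZp l.+1 :> Zmod p.
  by apply/inZp_eqP => //; rewrite val_inZp // modn_dvdm.
by rewrite !rep1_inZpS // modn_small //= addnS -divn_eq.
Qed.

Lemma represented_of_shift : exists t : triple n p, represents t pi.
Proof.
have [k cop ck] := shiftE.
pose R := [ffun y : Zmod p => Ordinal (rep1_quotient_ltn (pi1 y))].
exists (perm perm_mod_inj, R, k); split.
  by rewrite /admissible gcdnC; apply/eqP.
move=> x; have [j _ ->] := inZp_surj n n_gt0 x.
rewrite triple_funE inZpD // inZpM // -ck permE ffunE /= quotient_rep1K.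
(* The index [j + 1] is reached from [j %% p + 1] by [j %/ p] shifts of [p]. *)
by rewrite /pi1 rep1_inZpS // -perm_shift -inZpD // addSn addnC -divn_eq.
Qed.

End FromPerm.
End Triples.

Theorem theorem3p16 (n p : nat) (n_gt0 : 0 < n) (p_gt0 : 0 < p)
    (p_dvd_n : p %| n) :
  [/\ forall pi : {perm Zmod n},
        period_dvd p (diffseq pi) <-> exists t : triple n p, represents t pi,
      forall t : triple n p, admissible t ->
        exists! pi : {perm Zmod n}, represents t pi
    & forall (pi : {perm Zmod n}) (t t' : triple n p),
        represents t pi -> represents t' pi -> t = t'].
Proof.
split=> [pi|t adm|pi t t' [_ pit] [_ pit']].
- split=> [/(period_dvd_diffseqP _ _ n_gt0)[c]|]; first exact: represented_of_shift.
  case=> [[[phi R] k]] [_ pit]; apply/period_dvd_diffseqP => //.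
  exists (inZp (rep1 (n %/ p) k * p)) => x.
  by rewrite !pit triple_fun_shift.
- have inj := @triple_fun_inj n p n_gt0 p_gt0 p_dvd_n t adm.
  exists (perm inj); split=> [|pi [_ pit]]; first by split=> // i; rewrite permE.
  by apply/permP => i; rewrite permE pit.
- by apply: triple_fun_injl => // x; rewrite -pit -pit'.
Qed.
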